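(* Let $k \geq 2$. A position $(a_1,a_2,\ldots,a_k)$ of the game Max-Welter has Sprague-Grundy value $1$ if and only if at least one of the following conditions holds: (a) $(a_1,a_2,\ldots,a_k) = (0,1,\ldots,l,l+2,l+3,\ldots,k)$ for some integer $l$ with $0 \leq l \leq k-2$ (that is, the occupied squares are exactly the elements of $\{0,1,\ldots,k\}\setminus\{l+1\}$); (b) $a_k=a_{k-1}+1$ and $a_{k-1}+k$ is odd.
   Context: Max-Welter is played with a finite number of coins on a semi-infinite strip of squares labeled $0,1,2,3,\ldots$ from its left end, each square containing at most one coin. A position with $k$ coins in squares $a_1<a_2<\cdots<a_k$ (nonnegative integers) is denoted $(a_1,a_2,\ldots,a_k)$. Two players move alternately; a move consists of taking the coin in the largest occupied square $a_k$ and moving it to any empty square on its left (jumping over other coins is legal). Only the rightmost coin of the current position may be moved; after a move the coins are re-indexed in increasing order. The player first unable to move loses. The Sprague-Grundy value $\mathcal{G}(p)$ of a position $p$ is defined recursively as the smallest nonnegative integer not equal to $\mathcal{G}(q)$ for any $q$ reachable from $p$ in one move (so a terminal position has value $0$). *)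

(* Defs.v *)
From mathcomp Require Import all_boot.

Set Implicit Arguments.
Unset Strict Implicit.
Unset Printing Implicit Defensive.

(* A position is the strictly increasing list of its occupied squares, so that
   the coin that may be moved is the one in square [last 0 p].  The terms of
   [moves] are sorted again, which is the re-indexing of the coins. *)
Definition moves (p : seq nat) : seq (seq nat) :=
  [seq sort leq (b :: rem (last 0 p) p) | b <- iota 0 (last 0 p) & b \notin p].

(* [mex s] is at most [size s], so a search below [(size s).+1] is enough:
   see [mex_notin] and [lt_mex]. *)
Definition mex (s : seq nat) : nat :=
  find [pred n | n \notin s] (iota 0 (size s).+1).

(* A move decreases the sum of the occupied squares, so [sumn p] is enough fuel:
   [grundyE] is the recursive definition of the Sprague-Grundy value. *)
Fixpoint grundy_rec (n : nat) (p : seq nat) : nat :=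
  if n is m.+1 then mex [seq grundy_rec m q | q <- moves p] else 0.

Definition grundy (p : seq nat) : nat := grundy_rec (sumn p) p.

Lemma mex_has s : has [pred n | n \notin s] (iota 0 (size s).+1).
Proof.
apply: contraT => /hasPn s_all.
suff: size (iota 0 (size s).+1) <= size s by rewrite size_iota ltnn.
by apply: uniq_leq_size (iota_uniq _ _) _ => n /s_all /=; rewrite negbK.
Qed.

Lemma mex_notin s : mex s \notin s.
Proof.
have := nth_find 0 (mex_has s).
by rewrite nth_iota // -[X in _ < X](size_iota 0) -has_find mex_has.
Qed.

Lemma lt_mex s n : n < mex s -> n \in s.
Proof.
move=> lt_n; have := before_find 0 lt_n.
rewrite nth_iota /= => [/negbFE //|].
by apply: leq_trans lt_n _; rewrite -[X in _ <= X](size_iota 0) find_size.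
Qed.

Lemma moves_sumn p q : q \in moves p -> sumn q < sumn p.
Proof.
case/mapP => b; rewrite mem_filter mem_iota => /andP[_ /= lt_b] ->.
have p_last: last 0 p \in p.
  by case: p lt_b => // x p _; rewrite /= mem_last.
rewrite (perm_sumn (permEl (perm_sort _ _))) /=.
by rewrite (perm_sumn (perm_to_rem p_last)) /= ltn_add2r.
Qed.

Lemma moves_sorted p q : sorted ltn p -> q \in moves p ->
  sorted ltn q /\ size q = size p.
Proof.
move=> p_sorted /mapP[b].
rewrite mem_filter mem_iota => /andP[b_notin /= lt_b] ->.
have p_last: last 0 p \in p.
  by case: (p) lt_b => // x p' _; rewrite /= mem_last.
split; last by rewrite size_sort (perm_size (perm_to_rem p_last)).
rewrite ltn_sorted_uniq_leq sort_uniq sort_sorted; last exact: leq_total.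
move: p_sorted; rewrite ltn_sorted_uniq_leq => /andP[p_uniq _].
by rewrite /= rem_uniq // andbT (contra _ b_notin) //; apply: mem_rem.
Qed.

Lemma moves0 p : sumn p = 0 -> moves p = [::].
Proof.
move=> p0; case def_m: (moves p) => [|q s] //.
by have := @moves_sumn p q; rewrite def_m mem_head p0 => /(_ isT).
Qed.

Lemma grundy_rec_stable m n p :
  sumn p <= m -> sumn p <= n -> grundy_rec m p = grundy_rec n p.
Proof.
elim: m n p => [|m IHm] [|n] p //=; rewrite ?leqn0.
- by move=> /eqP/moves0 ->.
- by move=> _ /eqP/moves0 ->.
move=> le_m le_n; congr mex; apply/eq_in_map => q /moves_sumn lt_q.
by apply: IHm; rewrite -ltnS; apply: leq_trans lt_q _.
Qed.

Lemma grundyE p : grundy p = mex [seq grundy q | q <- moves p].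
Proof.
rewrite /grundy (@grundy_rec_stable _ (sumn p).+1) //=.
congr mex; apply/eq_in_map => q /moves_sumn lt_q.
by apply: grundy_rec_stable => //; apply: ltnW.
Qed.

(* Main.v *)
Require Import Defs.
From mathcomp Require Import all_boot.
From mathcomp Require Import zify.

Set Implicit Arguments.
Unset Strict Implicit.
Unset Printing Implicit Defensive.

(** Let [M] and [n] be the squares of the two rightmost of [k >= 2] coins.  The
value is 0 iff [n = M + 1] and [M + k] is even.  The reason why parity decides
is that a coin jumping over [M] leaves [M] as the rightmost square, so that from
adjacent coins on [M] and [M + 1] every move shifts the rightmost square by one;
conversely some jump leaves [M - 1] and [M] occupied unless the coins left of
[n] fill [{0, ..., M}].  The same argument with the opposite parity gives the
value 1; there the full case, whose position of value 1 has [n = k], accounts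
for the exceptional family (a). *)

(** * Grundy values 0 and 1 in terms of the moves *)

Lemma mexP s n : mex s = n <-> n \notin s /\ forall m, m < n -> m \in s.
Proof.
split=> [<-|[n_s lt_s]]; first by split; [apply: mex_notin | apply: lt_mex].
case: (ltngtP (mex s) n) => // [/lt_s|/lt_mex].
  by rewrite (negbTE (mex_notin s)).
by rewrite (negbTE n_s).
Qed.

Lemma grundy_eq0 p : grundy p = 0 <-> forall q, q \in moves p -> grundy q <> 0.
Proof.
rewrite grundyE mexP; split=> [[n0 _] q pq q0|n0].
  by case/negP: n0; rewrite -q0 map_f.
by split=> //; apply/negP => /mapP[q pq /esym]; apply: n0.
Qed.

(** A nonzero mex means that 0 already occurs among the values of the moves, so no move of value 0
    has to be exhibited. *)
Lemma grundy_eq1 p : grundy p = 1 <->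
  grundy p <> 0 /\ forall q, q \in moves p -> grundy q <> 1.
Proof.
split=> [p1|[p0 n1]].
  split=> [|q pq q1]; first by rewrite p1.
  move: p1; rewrite grundyE mexP => -[/negP n1 _]; case: n1.
  by rewrite -q1 map_f.
rewrite grundyE mexP; split=> [|[|//] _].
  by apply/negP => /mapP[q pq /esym]; apply: n1.
by apply: lt_mex; rewrite -grundyE lt0n; apply/eqP.
Qed.

(** * Increasing lists and their holes *)

Lemma ltn_sorted_uniq s : sorted ltn s -> uniq s.
Proof. exact: sorted_uniq ltn_trans ltnn _. Qed.

Lemma mem_last0 s : s != [::] -> last 0 s \in s.
Proof. by case: s => // x s _; apply: mem_last. Qed.

Lemma leq_last s x : sorted ltn s -> x \in s -> x <= last 0 s.
Proof.
case/lastP: s => // s n; rewrite (sorted_pairwise ltn_trans) pairwise_rcons.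
case/andP=> /allP lt_n _; rewrite mem_rcons inE last_rcons.
by case/orP=> [/eqP-> //|/lt_n/ltnW].
Qed.

Lemma last_sorted_eq s m : sorted ltn s -> m \in s ->
  (forall x, x \in s -> x <= m) -> last 0 s = m.
Proof.
move=> s_sorted m_s s_le; apply/eqP; rewrite eqn_leq leq_last // andbT s_le //.
by apply: mem_last0; case: (s) m_s.
Qed.

Lemma size_leq_last s : sorted ltn s -> size s <= (last 0 s).+1.
Proof.
move=> s_sorted; rewrite -[leqRHS](size_iota 0).
apply: uniq_leq_size; first exact: ltn_sorted_uniq.
by move=> x /(leq_last s_sorted) le_x; rewrite mem_iota.
Qed.

(** In the second case, adding a coin on [b] keeps the top square and makes it adjacent to the next
    coin: [b] is the square below the top if that is free, and any hole otherwise. *)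
Lemma full_or_gap s : sorted ltn s -> s != [::] ->
  (last 0 s).+1 = size s \/
  exists b, [/\ b < last 0 s, b \notin s & (last 0 s).-1 \in b :: s].
Proof.
move=> s_sorted s_n0; have last_s := mem_last0 s_n0.
have := size_leq_last s_sorted; rewrite leq_eqVlt => /orP[/eqP->|lt_size].
  by left.
right; case: (boolP ((last 0 s).-1 \in s)) => [M_s|M_s]; last first.
  exists (last 0 s).-1; rewrite M_s mem_head; split=> //.
  by case: (last 0 s) last_s M_s => // ->.
have [/hasP[b]|/hasPn s_full] :=
    boolP (has [pred b | b \notin s] (iota 0 (last 0 s))).
  rewrite mem_iota => /andP[_ lt_b] b_s.
  by exists b; rewrite inE M_s orbT.
suff: (last 0 s).+1 <= size s by rewrite leqNgt lt_size.
rewrite -[leqLHS](size_iota 0).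
apply: uniq_leq_size (iota_uniq _ _) _ => x; rewrite mem_iota /= ltnS leq_eqVlt.
case/orP=> [/eqP-> //|lt_x].
by have := s_full x; rewrite /= negbK; apply; rewrite mem_iota.
Qed.

(** With [s] the coins that stay, this is the position once the moving coin has landed on [b]. *)
Definition put b s := sort leq (b :: s).

Lemma size_put b s : size (put b s) = (size s).+1.
Proof. by rewrite size_sort. Qed.

Lemma mem_put b s : put b s =i b :: s.
Proof. exact: mem_sort. Qed.

Lemma put_sorted b s : sorted ltn s -> b \notin s -> sorted ltn (put b s).
Proof.
move=> s_sorted b_s; rewrite ltn_sorted_uniq_leq sort_uniq /= b_s.
by rewrite ltn_sorted_uniq // sort_sorted //; apply: leq_total.
Qed.

Lemma last_put b s : sorted ltn s -> b \notin s -> s != [::] ->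
  last 0 (put b s) = maxn b (last 0 s).
Proof.
move=> s_sorted b_s s_n0; apply: last_sorted_eq; first exact: put_sorted.
  rewrite mem_put inE; case: leqP => _; last by rewrite eqxx.
  by rewrite mem_last0 ?orbT.
move=> x; rewrite mem_put inE leq_max => /orP[/eqP->|/(leq_last s_sorted)->].
  by rewrite leqnn.
by rewrite orbT.
Qed.

Lemma mem_moves s n q : sorted ltn (rcons s n) ->
  (q \in moves (rcons s n)) <-> exists b, [/\ b < n, b \notin s & q = put b s].
Proof.
move=> sn_sorted.
have put_rem b: sort leq (b :: rem n (rcons s n)) = put b s.
  apply/(perm_sortP leq_total leq_trans anti_leq); rewrite perm_cons.
  rewrite -(perm_cons n) perm_sym -(perm_rcons n s).
  by apply: perm_to_rem; rewrite mem_rcons mem_head.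
rewrite /moves last_rcons; split=> [/mapP[b]|[b [lt_b b_s ->]]].
  rewrite mem_filter mem_iota mem_rcons inE negb_or.
  by case/andP=> /andP[_ b_s] /= lt_b ->; exists b; rewrite put_rem.
apply/mapP; exists b; last by rewrite put_rem.
by rewrite mem_filter mem_iota mem_rcons inE negb_or b_s lt_b neq_ltn lt_b.
Qed.

(* On positions: the two rightmost coins are adjacent.  The first conjunct
   guards against the truncated predecessor [0.-1 = 0]. *)
Definition adjacent p := (0 < last 0 p) && ((last 0 p).-1 \in p).
(** The parity is read at the larger of the two adjacent coins, hence opposite to that of
    [M + k]. *)
Definition is_zero p := adjacent p && odd (last 0 p + size p).
(** The parity test is automatic when [last 0 p == size p], so one conjunct serves both cases. *)
Definition is_one p :=
  ~~ odd (last 0 p + size p) && ((last 0 p == size p) || adjacent p).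

(** * Moves between the candidate positions *)

Section Moves.

Variables (s : seq nat) (n : nat).
Hypotheses (sn_sorted : sorted ltn (rcons s n)) (s_n0 : s != [::]).

Let M := last 0 s.

Lemma rcons_sorted_inv : sorted ltn s /\ M < n.
Proof.
rewrite /M; case: s s_n0 sn_sorted => // x s' _ /=.
by rewrite rcons_path => /andP[].
Qed.

Let s_sorted : sorted ltn s. Proof. by case: rcons_sorted_inv. Qed.
Let lt_Mn : M < n. Proof. by case: rcons_sorted_inv. Qed.
Let le_M x : x \in s -> x <= M. Proof. exact: leq_last. Qed.
Let M_s : M \in s. Proof. exact: mem_last0. Qed.
Let gt_M x : M < x -> x \notin s.
Proof. by move=> lt_x; apply: contraL lt_x => /le_M; rewrite -leqNgt. Qed.

Lemma adjacent_rcons : adjacent (rcons s n) = (n == M.+1).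
Proof.
rewrite /adjacent last_rcons mem_rcons inE.
have -> : (n.-1 == n) = false by lia.
apply/andP/eqP => [[n_gt0 /le_M]|->] //=; lia.
Qed.

Lemma adjacent_put_next : adjacent (put M.+1 s).
Proof.
rewrite /adjacent last_put ?gt_M // mem_put -/M.
by rewrite (maxn_idPl (leqnSn M)) inE /= M_s orbT.
Qed.

Lemma adjacent_put_gap b :
  b < M -> b \notin s -> M.-1 \in b :: s -> adjacent (put b s).
Proof.
move=> lt_b b_s M1; rewrite /adjacent last_put // mem_put -/M.
by rewrite (maxn_idPr (ltnW lt_b)) M1 (leq_trans _ lt_b).
Qed.

Lemma last_put_adjacent b : n = M.+1 -> b < n -> b \notin s ->
  last 0 (put b s) = M.
Proof.
move=> -> le_b b_s; rewrite last_put // -/M; apply/maxn_idPr.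
by rewrite -ltnS.
Qed.

Lemma zero_moveP :
  ~~ is_zero (rcons s n) <-> exists2 q, q \in moves (rcons s n) & is_zero q.
Proof.
rewrite /is_zero adjacent_rcons last_rcons size_rcons.
split=> [nz|[q /(mem_moves _ sn_sorted)[b [lt_b b_s ->]]]]; last first.
  apply: contraL => /andP[/eqP n_M n_odd].
  by rewrite (last_put_adjacent n_M) // size_put; lia.
have [odd_M|even_M] := boolP (odd (M + (size s).+1)).
  (* If [s] were full, [M + 1 = size s] would make [M + (size s).+1] even. *)
  have [Mfull|[b [lt_b b_s M1]]] := full_or_gap s_sorted s_n0.
    by move: odd_M; rewrite -/M in Mfull; lia.
  exists (put b s).
    by apply/(mem_moves _ sn_sorted); exists b; rewrite b_s (ltn_trans lt_b).
  rewrite adjacent_put_gap // last_put // (maxn_idPr (ltnW lt_b)) size_put.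
  exact: odd_M.
(* With this parity [n = M + 1] would make the position satisfy [is_zero]. *)
have lt_M1 : M.+1 < n by lia.
exists (put M.+1 s).
  by apply/(mem_moves _ sn_sorted); exists M.+1; rewrite gt_M.
rewrite adjacent_put_next last_put ?gt_M // (maxn_idPl (leqnSn M)).
by rewrite size_put; lia.
Qed.

Lemma one_no_move q :
  is_one (rcons s n) -> q \in moves (rcons s n) -> ~~ is_one q.
Proof.
move=> p1 /(mem_moves _ sn_sorted)[b [lt_b b_s ->]].
(* For [n = k] this bound forces the top square after the move to be exactly [k - 1], which has the
   wrong parity. *)
have := size_leq_last (put_sorted s_sorted b_s).
move: p1; rewrite /is_one adjacent_rcons last_rcons !size_put size_rcons.
case/andP=> n_even /orP[/eqP n_size|/eqP n_M]; last first.
  by rewrite (last_put_adjacent n_M) //; lia.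
rewrite last_put // -/M; lia.
Qed.

Lemma one_move : ~~ is_one (rcons s n) -> ~~ is_zero (rcons s n) ->
  exists2 q, q \in moves (rcons s n) & is_one q.
Proof.
rewrite /is_one /is_zero adjacent_rcons last_rcons size_rcons => n1 nz.
(* Adjacent top coins would give [is_zero] or [is_one], according to parity. *)
have lt_M1: M.+1 < n by lia.
have moveP b : b < n -> b \notin s -> put b s \in moves (rcons s n).
  by move=> lt_b b_s; apply/(mem_moves _ sn_sorted); exists b.
have [odd_M|even_M] := boolP (odd (M + (size s).+1)).
  exists (put M.+1 s); first by rewrite moveP ?gt_M.
  rewrite adjacent_put_next last_put ?gt_M // (maxn_idPl (leqnSn M)) size_put.
  lia.
have [|[b [lt_b b_s M1]]] := full_or_gap s_sorted s_n0.
  (* No hole below [M] is left, but here [M + 2 = k], so landing on [M + 2] gives [last = size].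
     This square lies below [n], since [n = k] would satisfy [is_one]. *)
  rewrite -/M => Mfull; have b_s: M.+2 \notin s by rewrite gt_M //; lia.
  exists (put M.+2 s); first by rewrite moveP //; lia.
  by rewrite last_put // size_put -/M; lia.
exists (put b s); first by rewrite moveP // (ltn_trans lt_b).
rewrite adjacent_put_gap // last_put // (maxn_idPr (ltnW lt_b)) size_put.
by rewrite even_M orbT.
Qed.

End Moves.

(** * Induction over positions with at least two coins *)

Lemma position_ind (P : seq nat -> Prop) :
  (forall s n, sorted ltn (rcons s n) -> s != [::] ->
     (forall q, q \in moves (rcons s n) -> P q) -> P (rcons s n)) ->
  forall p, sorted ltn p -> 1 < size p -> P p.
Proof.
move=> IH p; have [m] := ubnP (sumn p).
elim: m p => // m IHm p /ltnSE le_p p_sorted p_size.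
case/lastP: p => // s n in p_sorted p_size le_p *.
apply: IH => // [|q pq].
  by rewrite size_rcons in p_size; case: (s) p_size.
have [q_sorted q_size] := moves_sorted p_sorted pq.
by apply: IHm; rewrite ?q_size // (leq_trans (moves_sumn pq)).
Qed.

Lemma grundy_zero p : sorted ltn p -> 1 < size p ->
  grundy p = 0 <-> is_zero p.
Proof.
move: p; apply: position_ind => s n sn_sorted s_n0 IH.
have zP := zero_moveP sn_sorted s_n0; rewrite grundy_eq0; split=> [n0|pz q pq].
  apply: contraT => /zP[q pq qz]; case: (n0 q pq).
  by apply/IH.
by move/(IH q pq) => qz; have /negP := proj2 zP (ex_intro2 _ _ q pq qz).
Qed.

Lemma grundy_one p : sorted ltn p -> 1 < size p ->
  grundy p = 1 <-> is_one p.
Proof.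
move=> p_sorted p_size; have zero_p := grundy_zero p_sorted p_size.
move: zero_p; move: p p_sorted p_size.
apply: position_ind => s n sn_sorted s_n0 IH zero_p.
have size_p: 1 < size (rcons s n).
  by rewrite size_rcons; case: (s) s_n0.
(* The induction carries the characterisation of value 0 as a premise, discharged here for each
   move. *)
have {}IH q : q \in moves (rcons s n) -> grundy q = 1 <-> is_one q.
  move=> pq; apply: IH (pq) _.
  have [q_sorted q_size] := moves_sorted sn_sorted pq.
  by apply: grundy_zero; rewrite ?q_size.
rewrite grundy_eq1 zero_p; split=> [[/negP nz n1]|p1].
  apply: contraT => np1; have [q pq q1] := one_move sn_sorted s_n0 np1 nz.
  by case: (n1 q pq); apply/IH.
split=> [|q pq /(IH q pq)].
  (* [is_one] and [is_zero] demand opposite parities. *)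
  by move: p1; rewrite /is_one /is_zero => /andP[/negbTE->]; rewrite andbF.
by apply/negP; apply: one_no_move pq.
Qed.

(** Here [size p] coins lie on the [(size p).+1] squares up to the last one, so exactly one square
    [m] is empty; [m = 0] is allowed. *)
Lemma last_eq_sizeP p : sorted ltn p -> p != [::] -> last 0 p = size p <->
  exists2 m, m < size p & p = index_iota 0 m ++ index_iota m.+1 (size p).+1.
Proof.
move=> p_sorted p_n0; split=> [last_p|[m lt_m def_p]]; last first.
  have mem_p x : x \in p = (x < m) || (m < x <= size p).
    by rewrite {1}def_p mem_cat !mem_index_iota.
  by apply: last_sorted_eq => // [|x]; rewrite mem_p; lia.
have [s_p|[m [lt_m m_p _]]] := full_or_gap p_sorted p_n0; first by lia.
exists m; first by rewrite -last_p.
(* Adding the hole gives as many distinct elements as the interval containing them, hence all of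
   it. *)
have mem_p: m :: p =i iota 0 (size p).+1.
  have mp_uniq: uniq (m :: p) by rewrite /= m_p ltn_sorted_uniq.
  apply: (uniq_min_size mp_uniq _ _).2; last by rewrite size_iota.
  move=> x; rewrite inE mem_iota ltnS -last_p => /orP[/eqP->|/leq_last->] //.
  exact: ltnW.
apply: (irr_sorted_eq ltn_trans ltnn) => // [|x].
  rewrite (sorted_pairwise ltn_trans) pairwise_cat.
  rewrite -!(sorted_pairwise ltn_trans) !iota_ltn_sorted !andbT.
  apply/allrelP => x y.
  by rewrite !mem_index_iota => /andP[_ lt_x] /andP[lt_y _]; lia.
have := mem_p x; rewrite inE mem_cat !mem_index_iota mem_iota.
by case: eqVneq m_p => [-> /negbTE->|]; lia.
Qed.

Theorem theorem2 (k : nat) (a : k.-tuple nat) (hk : 2 <= k)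
    (ha : sorted ltn a) :
  grundy a = 1 <->
  (exists l : nat, l <= k - 2 /\
     tval a = index_iota 0 l.+1 ++ index_iota l.+2 k.+1) \/
  (nth 0 a (k - 1) = nth 0 a (k - 2) + 1 /\ odd (nth 0 a (k - 2) + k)).
Proof.
have size_a := size_tuple a.
have a_n0: tval a != [::] by rewrite -size_eq0 size_a; lia.
rewrite grundy_one ?size_a // /is_one size_a.
have last_size := last_eq_sizeP ha a_n0; rewrite size_a in last_size.
have [s [n [def_a s_n0]]] : exists s n, tval a = rcons s n /\ s != [::].
  case/lastP def_a: (tval a) size_a => [|s n] size_sn.
    by rewrite -size_sn in hk.
  rewrite size_rcons in size_sn; exists s, n; split=> //.
  by rewrite -size_eq0 -lt0n -ltnS size_sn.
have last_a: nth 0 a (k - 1) = last 0 a by rewrite subn1 -nth_last size_a.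
have size_s: (size s).+1 = k by rewrite -size_a def_a size_rcons.
have last_s: nth 0 a (k - 2) = last 0 s.
  rewrite def_a nth_rcons -size_s subSS subn1 prednK ?leqnn ?nth_last //.
  by rewrite lt0n size_eq0.
have ha' := ha; rewrite def_a in ha'.
have adjP : adjacent a = (last 0 a == (last 0 s).+1).
  by rewrite def_a adjacent_rcons // last_rcons.
rewrite last_a last_s adjP; split.
  case/andP=> even_k /orP[/eqP last_k|/eqP last_M]; last by right; lia.
  (* A hole at [m.+1] is family (a) with [l = m]. A hole at 0 gives the squares from 1 to [k],
     outside (a) but covered by (b), as [(k - 1) + k] is odd. *)
  have [[|m] lt_m def_m] := proj1 last_size last_k; last first.
    by left; exists m; split=> //; lia.
  have M_eq: last 0 s = 1 + (k - 2).
    by rewrite -last_s def_m /= nth_iota //; lia.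
  by right; lia.
case=> [[l [le_l def_l]]|[-> odd_k]]; last by lia.
have -> : last 0 a = k by apply/last_size; exists l.+1 => //; lia.
by rewrite addnn odd_double eqxx.
Qed.
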